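(* Let $d\ge 2$ and $r\ge 3$ be integers and let $n=(r-1)(d+1)+1$. If $X\subset\mathbb{R}^d$ is a set with $|X|=n$ that is in a-general position, then $X$ is $r$-divisible.
   Context: A finite set $X=\{a_1,\ldots,a_m\}\subset\mathbb{R}^d$ of $m$ points is in a-general position if the $dm$ real numbers that are the coordinates of $a_1,\ldots,a_m$ are algebraically independent (over $\mathbb{Q}$). A finite set $X\subset\mathbb{R}^d$ is called $r$-divisible if there is a partition of $X$ into $r$ parts $X_1,\ldots,X_r$ (pairwise disjoint, with union $X$) such that $\bigcap_{p=1}^r \mathrm{conv}\, X_p\neq\emptyset$, where $\mathrm{conv}$ denotes the convex hull. *)

(* Defs.v *)
From mathcomp Require Import all_boot all_order all_algebra.
From mathcomp Require Import finmap mpoly.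
From mathcomp Require Import boolp classical_sets reals convex.

Set Implicit Arguments.
Unset Strict Implicit.
Unset Printing Implicit Defensive.

Import GRing.Theory Num.Theory.

Local Open Scope classical_set_scope.
Local Open Scope ring_scope.

(* Independence of the family x, not of its set of values: a family with a
   repeated value is dependent. *)
Definition algebraically_independent (R : realType) (T : finType)
    (x : T -> R) : Prop :=
  forall p : {mpoly rat[#|T|]},
    (map_mpoly ratr p).@[fun k : 'I_#|T| => x (enum_val k)] = 0 -> p = 0.

Definition a_general_position (R : realType) (d : nat)
    (X : {fset 'rV[R]_d}) : Prop :=
  algebraically_independent (fun ai : X * 'I_d => val ai.1 ord0 ai.2).

Definition convex_hull (R : realType) (d : nat) (A : set 'rV[R]_d) :
    set 'rV[R]_d :=
  smallest (@convex_set R 'rV[R]_d) A.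

(* [partition] asks for nonempty parts; this is no restriction here, since an
   empty part would have an empty convex hull. *)
Definition divisible (R : realType) (d r : nat) (X : {fset 'rV[R]_d}) : Prop :=
  exists2 F : 'I_r -> set 'rV[R]_d,
    classical_sets.partition [set: 'I_r] F [set` X] &
    \bigcap_(p in [set: 'I_r]) convex_hull (F p) !=set0.

(* Main.v *)
Require Import Defs.
From mathcomp Require Import all_boot all_order all_algebra.
From mathcomp Require Import finmap reals.
From mathcomp Require Import boolp classical_sets interval_inference convex.
From mathcomp Require Import topology normedtype derive.
From mathcomp Require Import ring.

(** This is Tverberg's theorem, which holds for every set of
    [(r - 1) * (d + 1) + 1] points; the proof is Sarkaria's derivation from the
    colourful Caratheodory theorem.

    Colourful Caratheodory ([colourful_caratheodory]): among all choices of one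
    point of each colour, take one whose convex hull comes nearest to the
    origin, at a point [z]; it exists because there are finitely many choices
    and each hull is the image of a compact simplex. If [z] is not the origin,
    then all chosen points lie on or beyond the hyperplane through [z]
    orthogonal to [z] ([segment_min_dot]), and those of positive weight lie on
    it. If all of them do, they are affinely dependent, being too many for the
    dimension of the hyperplane; so in any case [z] can be written with weight
    zero at some colour ([simplex_min_support]). The hull of that colour
    contains the origin, hence the colour has a point [u] with [dot z u <= 0].
    Exchanging the chosen point of that colour for [u] keeps [z] in the hull and
    brings the hull nearer to the origin, a contradiction.

    Tverberg ([tverberg]): take [r] vectors whose only linear dependence, up to
    a factor, is that their sum vanishes, and let the tensors of [(x, 1)] with
    these vectors be the colour of the point [x]. A colourful choice assigns to
    each point a class, and the vanishing convex combination says that the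
    weighted sums of [(x, 1)] over the classes are all equal. Their last
    coordinates show that the classes have equal weights, and the other ones
    that the weighted barycentres coincide. *)

Set Implicit Arguments.
Unset Strict Implicit.
Unset Printing Implicit Defensive.

Import Order.TTheory GRing.Theory Num.Theory numFieldNormedType.Exports.

Local Open Scope classical_set_scope.
Local Open Scope ring_scope.

(** * Scalar product of row vectors *)

(** The standard scalar product [u *m v^T], as a scalar. *)
Definition dot (R : pzRingType) (n : nat) (u v : 'rV[R]_n) : R :=
  \sum_k u 0 k * v 0 k.

Lemma dotC (R : comPzRingType) (n : nat) (u v : 'rV[R]_n) : dot u v = dot v u.
Proof. by apply: eq_bigr => k _; rewrite mulrC. Qed.

Lemma dotDr (R : pzRingType) (n : nat) (u v w : 'rV[R]_n) :
  dot u (v + w) = dot u v + dot u w.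
Proof. by rewrite -big_split; apply: eq_bigr => k _; rewrite mxE mulrDr. Qed.

Lemma dotZr (R : comPzRingType) (n : nat) (a : R) (u v : 'rV[R]_n) :
  dot u (a *: v) = a * dot u v.
Proof. by rewrite mulr_sumr; apply: eq_bigr => k _; rewrite mxE mulrCA. Qed.

Lemma dot0r (R : pzRingType) (n : nat) (u : 'rV[R]_n) : dot u 0 = 0.
Proof. by apply: big1 => k _; rewrite mxE mulr0. Qed.

Lemma dot_mulmx (R : comPzRingType) (m n : nat) (u : 'rV[R]_n) (l : 'rV[R]_m)
    (M : 'M[R]_(m, n)) :
  dot u (l *m M) = \sum_i l 0 i * dot u (row i M).
Proof.
transitivity (\sum_k \sum_i u 0 k * (l 0 i * M i k)).
  by apply: eq_bigr => k _; rewrite mxE mulr_sumr.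
rewrite exchange_big; apply: eq_bigr => i _; rewrite mulr_sumr.
by apply: eq_bigr => k _; rewrite mxE mulrCA.
Qed.

Lemma dot_ge0 (R : realDomainType) (n : nat) (u : 'rV[R]_n) : 0 <= dot u u.
Proof. by apply: sumr_ge0 => k _; rewrite -expr2 sqr_ge0. Qed.

Lemma dot_le0 (R : realDomainType) (n : nat) (u : 'rV[R]_n) :
  dot u u <= 0 -> u = 0.
Proof.
move=> u_le0; have /eqP : dot u u = 0.
  by apply/eqP; rewrite eq_le u_le0 dot_ge0.
rewrite psumr_eq0 => [/allP u0|k _]; last by rewrite -expr2 sqr_ge0.
apply/rowP => k; rewrite mxE; apply/eqP.
by have := u0 k (mem_index_enum k); rewrite /= mulf_eq0 orbb.
Qed.

(** If a nonzero [z] has minimal norm on the segment from [z] to [u], then [u]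
    is not on the origin's side of the hyperplane through [z] orthogonal to
    [z]. *)
Lemma segment_min_dot (R : realFieldType) (n : nat) (z u : 'rV[R]_n) :
  (forall t : R, 0 <= t -> t <= 1 ->
     dot z z <= dot (z + t *: (u - z)) (z + t *: (u - z))) ->
  dot z z <= dot z u.
Proof.
move=> zmin; set a := dot z (u - z); set b := dot (u - z) (u - z).
suff a0 : 0 <= a by rewrite -[u](subrK z) dotDr lerDr.
rewrite leNgt; apply/negP => a_lt0.
have b0 : 0 <= b by exact: dot_ge0.
have ba0 : 0 < b - a by rewrite subr_gt0 (lt_le_trans a_lt0).
(* any small enough positive value would do *)
pose t := - a / (b - a).
have t0 : 0 < t by rewrite divr_gt0 ?oppr_gt0.
have t1 : t <= 1 by rewrite ler_pdivrMr // mul1r lerDr.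
have := zmin t (ltW t0) t1; apply/negP; rewrite -ltNge.
have -> : dot (z + t *: (u - z)) (z + t *: (u - z)) =
    dot z z + t * (a + (a + t * b)).
  rewrite dotDr dotZr [dot _ z]dotC [dot _ (u - z)]dotC dotDr [in RHS]/b.
  by rewrite dotDr !dotZr [dot (u - z) z]dotC -/a; ring.
rewrite gtrDl pmulr_rlt0 //.
have tb : t * b <= - a.
  rewrite /t mulrAC ler_pdivrMr // ler_wpM2l ?oppr_ge0 ?(ltW a_lt0) //.
  by rewrite lerDl oppr_ge0 ltW.
by rewrite ltr_wnDr // -lerBrDl sub0r.
Qed.

(** * Convex combinations *)

(** Weight vectors of convex combinations of [n] points: [l *m M] with
    [simplex l] runs through the convex hull of the rows of [M]. *)
Definition simplex (R : numDomainType) (n : nat) : set 'rV[R]_n :=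
  [set l | (forall i, 0 <= l 0 i) /\ \sum_i l 0 i = 1].
Arguments simplex {R n}.

Lemma simplex_delta (R : numDomainType) (n : nat) (i : 'I_n) :
  simplex (delta_mx 0 i : 'rV[R]_n).
Proof.
split=> [j|]; first by rewrite mxE ler0n.
rewrite (bigD1 i) //= big1 ?addr0 => [|j /negPf ji]; first by rewrite mxE !eqxx.
by rewrite mxE ji andbF.
Qed.

Lemma simplex_conv (R : numDomainType) (n : nat) (t : R) (l1 l2 : 'rV[R]_n) :
  0 <= t -> t <= 1 -> simplex l1 -> simplex l2 ->
  simplex (l1 + t *: (l2 - l1)).
Proof.
move=> t0 t1 [l1_ge0 l1_sum] [l2_ge0 l2_sum]; split=> [i|].
  rewrite !mxE mulrBr addrCA -[X in _ + (X - _)]mul1r -mulrBl.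
  by rewrite addr_ge0 ?mulr_ge0 ?subr_ge0.
transitivity (\sum_i (l1 0 i + t * (l2 0 i - l1 0 i))).
  by apply: eq_bigr => i _; rewrite !mxE.
by rewrite big_split /= -mulr_sumr sumrB l1_sum l2_sum subrr mulr0 addr0.
Qed.

Lemma continuous_sum (R : realType) (T : topologicalType) (I : finType)
    (F : I -> T -> R) :
  (forall i, continuous (F i)) -> continuous (fun x => \sum_i F i x).
Proof.
move=> cF x; apply: (@cvg_big R I) => [|i _]; last exact: cF.
exact: add_continuous.
Qed.

Lemma simplex_compact (R : realType) (n : nat) : compact (@simplex R n).
Proof.
have -> : @simplex R n =
    [set l : 'rV[R]_n | forall i, [set` `[0 : R, 1]] (l 0 i)] `&`
    ((fun l : 'rV[R]_n => \sum_i l 0 i) @^-1` [set 1]).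
  apply/seteqP; split=> l /= [l01 l_sum]; split=> // i; last first.
    by have := l01 i; rewrite in_itv /= => /andP[].
  rewrite in_itv /= l01 /= -l_sum (bigD1 i) //= lerDl.
  by apply: sumr_ge0.
apply: compact_closedI.
  apply: (@rV_compact R n (fun=> [set` `[0 : R, 1]])) => i.
  exact: segment_compact.
apply: preimage_closed; last exact: closed_eq.
by move=> l _; apply: continuous_sum => i; exact: coord_continuous.
Qed.

Lemma simplex_min_norm (R : realType) (m n : nat) (M : 'M[R]_(m.+1, n)) :
  exists2 l, simplex l & forall l', simplex l' ->
    dot (l *m M) (l *m M) <= dot (l' *m M) (l' *m M).
Proof.
have [||l] := @EVT_min_rV R m.+1 (fun l => dot (l *m M) (l *m M)) simplex _
  (@simplex_compact R m.+1).
- by exists (delta_mx 0 0); exact: simplex_delta.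
- apply: continuous_subspaceT => l.
  have Mk k : continuous (fun l : 'rV[R]_m.+1 => (l *m M) 0 k).
    have -> : (fun l : 'rV[R]_m.+1 => (l *m M) 0 k) =
        (fun l => \sum_i l 0 i * M i k) by apply/funext => l'; rewrite mxE.
    apply: continuous_sum => i x.
    exact: (continuousM (@coord_continuous R 1 m.+1 0 i x)
                        (@cst_continuous _ R (M i k) x)).
  by apply: continuous_sum => k x; exact: continuousM (Mk k x) (Mk k x).
by rewrite inE => l_s lmin; exists l => // l' l's; apply: lmin; rewrite inE.
Qed.

(** Moving the weights along an affine dependence until one of them vanishes. *)
Lemma simplex_shift (R : realFieldType) (n : nat) (l c : 'rV[R]_n) :
  simplex l -> c != 0 -> \sum_i c 0 i = 0 ->
  exists t i, simplex (l + t *: c) /\ (l + t *: c) 0 i = 0.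
Proof.
move=> [l_ge0 l_sum] c_neq0 c_sum.
have [i0 ci0] : exists i, c 0 i < 0.
  apply/existsP; apply: contraNT c_neq0; rewrite negb_exists => /forallP c_ge0.
  have {}c_ge0 i : 0 <= c 0 i by rewrite leNgt c_ge0.
  have /eqP := c_sum; rewrite psumr_eq0 // => /allP c0.
  by apply/eqP/rowP => i; rewrite mxE; apply/eqP/c0/mem_index_enum.
(* the largest step that keeps all weights nonnegative *)
have [i ci imin] := @Order.TotalTheory.arg_minP _ R _ i0 (fun i => c 0 i < 0)
  (fun i => l 0 i / - c 0 i) ci0.
exists (l 0 i / - c 0 i), i; split; last first.
  by rewrite !mxE invrN mulrN mulNr divfK ?lt_eqF // subrr.
split=> [j|].
  rewrite !mxE; case: (ltP (c 0 j) 0) => [cj|cj]; last first.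
    by rewrite addr_ge0 // mulr_ge0 // divr_ge0 // oppr_ge0 ltW.
  by rewrite -[c 0 j]opprK mulrN subr_ge0 -ler_pdivlMr ?oppr_gt0 ?imin.
under eq_bigr => j _ do rewrite !mxE.
by rewrite big_split /= -mulr_sumr c_sum mulr0 addr0.
Qed.

(** If the nearest point to the origin of the convex hull of more than [n]
    points of the [n]-dimensional space is not the origin, then some point is
    not needed in writing it as a convex combination: points that all carry a
    positive weight lie on a common affine hyperplane, so they are affinely
    dependent. *)
Lemma simplex_min_support (R : realType) (n : nat) (M : 'M[R]_(n.+1, n))
    (l : 'rV[R]_n.+1) :
  simplex l -> l *m M != 0 ->
  (forall l', simplex l' ->
     dot (l *m M) (l *m M) <= dot (l' *m M) (l' *m M)) ->
  exists l' i, [/\ simplex l', l' *m M = l *m M & l' 0 i = 0].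
Proof.
move=> l_simplex; set z := l *m M => z_neq0 l_min.
have [l_ge0 l_sum] := l_simplex.
have [i li|l_neq0] := pickP (fun i => l 0 i == 0).
  by exists l, i; split=> //; exact/eqP.
have zz_neq0 : dot z z != 0.
  by apply: contra_neq z_neq0 => zz; apply: dot_le0; rewrite zz.
have zM i : dot z z <= dot z (row i M).
  apply: segment_min_dot => t t0 t1.
  rewrite rowE /z -mulmxBl scalemxAl -mulmxDl; apply: l_min.
  by apply: simplex_conv => //; exact: simplex_delta.
have zME i : dot z (row i M) = dot z z.
  have : \sum_j l 0 j * (dot z (row j M) - dot z z) = 0.
    under eq_bigr => j _ do rewrite mulrBr.
    by rewrite sumrB -dot_mulmx -mulr_suml l_sum mul1r subrr.
  move/eqP; rewrite psumr_eq0 => [/allP/(_ i (mem_index_enum i))|j _] /=.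
    by rewrite mulf_eq0 l_neq0 subr_eq0 => /eqP.
  by rewrite mulr_ge0 // subr_ge0.
have [c cM c_neq0] : exists2 c : 'rV_n.+1, c *m M = 0 & c != 0.
  have : kermx M != 0.
    by rewrite kermx_eq0 -row_leq_rank -ltnNge ltnS rank_leq_col.
  by case/rowV0Pn => c /sub_kermxP; exists c.
have c_sum : \sum_i c 0 i = 0.
  apply: (mulIf zz_neq0); rewrite mul0r mulr_suml.
  under eq_bigr => i _ do rewrite -(zME i).
  by rewrite -dot_mulmx cM dot0r.
have [t [i [tl_simplex tli]]] := simplex_shift l_simplex c_neq0 c_sum.
by exists (l + t *: c), i; rewrite mulmxDl -scalemxAl cM scaler0 addr0.
Qed.

(** * Colourful Caratheodory theorem *)

(** Each of the [n.+1] colours [i] is the set of rows of [C i]; if the convex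
    hull of every colour contains the origin, then so does the convex hull of
    some choice of one point [s i] of each colour. *)
Theorem colourful_caratheodory (R : realType) (n r : nat)
    (C : 'I_n.+1 -> 'M[R]_(r, n)) :
  (forall i, exists2 m, simplex m & m *m C i = 0) ->
  exists (s : {ffun 'I_n.+1 -> 'I_r}) l,
    simplex l /\ l *m (\matrix_i row (s i) (C i)) = 0.
Proof.
move=> C0; pose M (s : {ffun 'I_n.+1 -> 'I_r}) := \matrix_i row (s i) (C i).
have r_gt0 : (0 < r)%N.
  have [m [_ m_sum] _] := C0 ord0; rewrite lt0n; apply/eqP => r0.
  move: m m_sum; rewrite r0 => m /eqP; rewrite big_ord0 eq_sym.
  exact/negP/oner_neq0.
have /choice[w w_min] : forall s, exists l : 'rV[R]_n.+1, simplex l /\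
    forall l', simplex l' ->
      dot (l *m M s) (l *m M s) <= dot (l' *m M s) (l' *m M s).
  by move=> s; have [l] := simplex_min_norm (M s); exists l.
have [s _ s_min] := @Order.TotalTheory.arg_minP _ R _
  [ffun=> Ordinal r_gt0] xpredT (fun s => dot (w s *m M s) (w s *m M s)) isT.
exists s, (w s); have [ws_simplex ws_min] := w_min s; split=> //.
apply/eqP/negPn/negP => z_neq0.
have [l [i [l_simplex lM li0]]] :=
  simplex_min_support ws_simplex z_neq0 ws_min.
set z := w s *m M s in z_neq0 lM s_min.
have [j zj] : exists j, dot z (row j (C i)) <= 0.
  apply/existsP; apply: contraT; rewrite negb_exists => /forallP zC.
  have [m [m_ge0 m_sum] mC] := C0 i.
  have : \sum_j m 0 j * dot z (row j (C i)) = 0.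
    by rewrite -dot_mulmx mC dot0r.
  have {}zC k : 0 < dot z (row k (C i)) by rewrite ltNge zC.
  move/eqP; rewrite psumr_eq0 => [/allP m0|k _]; last first.
    by rewrite mulr_ge0 // ltW.
  have /eqP := oner_neq0 R; case; rewrite -m_sum big1 // => k _.
  apply/eqP; have := m0 k (mem_index_enum k).
  by rewrite mulf_eq0 (gt_eqF (zC k)) orbF.
(* the exchange does not move z, since its weight at colour i is zero *)
pose s' := [ffun k => if k == i then j else s k].
have lM' : l *m M s' = z.
  rewrite -lM !mulmx_sum_row; apply: eq_bigr => k _; rewrite !rowK ffunE.
  by case: eqP => // ->; rewrite li0 !scale0r.
have rM' : row i (M s') = row j (C i) by rewrite rowK ffunE eqxx.
move/eqP: z_neq0; apply; apply: dot_le0; apply: le_trans zj.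
apply: segment_min_dot => t t0 t1; apply: (le_trans (s_min s' isT)).
rewrite -rM' rowE -lM' -mulmxBl scalemxAl -mulmxDl.
have [_] := w_min s'; apply.
by apply: simplex_conv => //; exact: simplex_delta.
Qed.

(** * Tverberg theorem *)

(** The [r * (d + 1) + 1] points [x i], not necessarily distinct, are split
    into the [r + 1] classes of [s], and [y] is a convex combination of each
    class. *)
Theorem tverberg (R : realType) (d r : nat)
    (x : 'I_(r * (d + 1)).+1 -> 'rV[R]_d) :
  exists (s : 'I_(r * (d + 1)).+1 -> 'I_r.+1) (l : _ -> R) (y : 'rV[R]_d),
    (forall i, 0 <= l i) /\ forall j,
      \sum_(i | s i == j) l i = 1 /\ \sum_(i | s i == j) l i *: x i = y.
Proof.
pose x1 i : 'rV[R]_(d + 1) := row_mx (x i) (const_mx 1).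
(* the rows of V add up to zero, and this is their only linear dependence up
   to a factor *)
pose V : 'M[R]_(r.+1, r) :=
  \matrix_(j, k) ((j == lift ord0 k)%:R - (j == ord0)%:R).
have sumV (a : 'I_r.+1 -> R) k :
    \sum_j a j * V j k = a (lift ord0 k) - a ord0.
  under eq_bigr => j _ do rewrite mxE mulrBr.
  have sum_delta j : \sum_i a i * (i == j)%:R = a j.
    rewrite (bigD1 j) //= eqxx mulr1 big1 ?addr0 // => i /negPf ->.
    by rewrite mulr0.
  by rewrite sumrB !sum_delta.
have [|s [l [[l_ge0 l_sum] lC]]] := @colourful_caratheodory R (r * (d + 1))
    r.+1 (fun i => \matrix_j mxvec ((row j V)^T *m x1 i)).
  move=> i; exists (const_mx r.+1%:R^-1); first split=> [j|].
  - by rewrite mxE invr_ge0 ler0n.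
  - under eq_bigr => j _ do rewrite mxE.
    rewrite sumr_const card_ord -[X in X *+ _]mulr1 -mulrnAr.
    by rewrite mulVf ?pnatr_eq0.
  rewrite mulmx_sum_row; under eq_bigr => j _ do rewrite mxE rowK.
  rewrite -scaler_sumr -linear_sum -mulmx_suml.
  rewrite [X in X *m _](_ : _ = 0) ?mul0mx ?linear0 ?scaler0 //.
  apply/matrixP => k c; rewrite summxE mxE.
  transitivity (\sum_j 1 * V j k); last by rewrite (sumV (fun=> 1)) subrr.
  by apply: eq_bigr => j _; rewrite mul1r !mxE.
pose S j : 'rV[R]_(d + 1) := \sum_(i | s i == j) l 0 i *: x1 i.
(* the coefficient of row j of V in the vanishing combination is S j *)
have S_const j : S j = S ord0.
  case: (unliftP ord0 j) => [k ->|-> //]; apply/rowP => c; apply/eqP.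
  rewrite -subr_eq0 -(sumV (fun j => S j 0 c)); apply/eqP.
  have := congr1 (fun u => vec_mx u k c) lC; rewrite linear0 [RHS]mxE.
  rewrite mulmx_sum_row linear_sum summxE (partition_big s xpredT) //=.
  apply: etrans; apply: eq_bigr => j' _.
  rewrite summxE mulr_suml; apply: eq_bigr => i /eqP si.
  rewrite rowK linearZ /= rowK mxvecK !mxE big_ord1 !mxE si.
  by rewrite -mulrA; congr (_ * _); rewrite mulrC.
pose a := \sum_(i | s i == ord0) l 0 i.
have sum_l j : \sum_(i | s i == j) l 0 i = a.
  have := congr1 (fun u : 'rV[R]_(d + 1) => u 0 (rshift d 0)) (S_const j).
  rewrite !summxE.
  under eq_bigr => i _ do rewrite mxE row_mxEr mxE mulr1.
  by under [RHS]eq_bigr => i _ do rewrite mxE row_mxEr mxE mulr1.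
have sum_x j : \sum_(i | s i == j) l 0 i *: x i = lsubmx (S ord0).
  rewrite -(S_const j) linear_sum; apply: eq_bigr => i _.
  by rewrite linearZ /= row_mxKl.
(* every class carries the weight a = 1 / (r + 1) *)
have ra : r.+1%:R * a = 1.
  rewrite -[RHS]l_sum (partition_big s xpredT) //=.
  under eq_bigr => j _ do rewrite sum_l.
  by rewrite sumr_const card_ord mulr_natl.
exists s, (fun i => r.+1%:R * l 0 i), (r.+1%:R *: lsubmx (S ord0)).
split=> [i|j]; first by rewrite mulr_ge0 ?ler0n.
rewrite -mulr_sumr sum_l ra; split=> //.
by rewrite -(sum_x j) scaler_sumr; apply: eq_bigr => i _; rewrite scalerA.
Qed.

(** * Convex hulls *)

Lemma convex_set_sum (R : realFieldType) (E : lmodType R)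
    (A : set (convex_lmodType E)) (I : eqType) (q : seq I) (P : pred I)
    (l : I -> R) (x : I -> E) :
  convex_set A -> (forall i, P i -> A (x i)) -> (forall i, 0 <= l i) ->
  \sum_(i <- q | P i) l i = 1 -> A (\sum_(i <- q | P i) l i *: x i).
Proof.
move=> cA Ax l_ge0 l_sum.
(* normalizing by the total weight makes the claim fit for induction *)
suff sum_A : 0 < \sum_(i <- q | P i) l i ->
    A ((\sum_(i <- q | P i) l i)^-1 *: \sum_(i <- q | P i) l i *: x i).
  by have := sum_A; rewrite l_sum ltr01 invr1 scale1r; apply.
elim: q {l_sum} => [|i q IH]; first by rewrite !big_nil ltxx.
rewrite !big_cons; case: ifP => // Pi.
set b := \sum_(j <- q | P j) l j in IH *.
set y := \sum_(j <- q | P j) _ in IH *.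
have b_ge0 : 0 <= b by exact: sumr_ge0.
move=> lb_gt0.
have [b0|b_neq0] := eqVneq b 0.
  have -> : y = 0.
    have /eqP := b0; rewrite psumr_eq0 // => /allP l0.
    rewrite /y big_seq_cond big1 // => j /andP[jq Pj].
    by have := l0 j jq; rewrite Pj /= => /eqP ->; rewrite scale0r.
  move: lb_gt0; rewrite b0 !addr0 => li_gt0.
  by rewrite scalerA mulVf ?gt_eqF // scale1r; exact: Ax.
have b_gt0 : 0 < b by rewrite lt_neqAle eq_sym b_neq0.
have t01 : 0 <= l i / (l i + b) <= 1.
  by rewrite divr_ge0 ?(ltW lb_gt0) //= ler_pdivrMr // mul1r lerDl.
pose t := Itv01 (andP t01).1 (andP t01).2.
have -> : (l i + b)^-1 *: (l i *: x i + y) =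
    t%:num *: x i + (1 - t%:num) *: (b^-1 *: y).
  rewrite scalerDr !scalerA /= [_ * l i]mulrC; congr (_ + _ *: _).
  by field; rewrite b_neq0 gt_eqF.
have := cA (x i) (b^-1 *: y) t; rewrite !inE; apply; first exact: Ax.
exact: IH.
Qed.

(** * Divisibility of finite sets *)

Theorem theorem1p2 (R : realType) (d r : nat) (X : {fset 'rV[R]_d}) :
  (2 <= d)%N -> (3 <= r)%N ->
  #|` X|%fset = ((r - 1) * (d + 1) + 1)%N ->
  a_general_position X ->
  divisible r X.
Proof.
case: r => // r _ _; rewrite subSS subn0 addn1 => cardX _.
pose x (i : 'I_(r * (d + 1)).+1) : 'rV[R]_d := nth 0 (enum_fset X) i.
have lt_size (i : 'I_(r * (d + 1)).+1) : (i < size (enum_fset X))%N.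
  by rewrite cardX.
have [s [l [y [l_ge0 sl]]]] := tverberg x.
exists (fun j => [set x i | i in [set i | s i = j]]).
- split=> [|j k _ _ [_ [[i <- <-] [i' <- xi]]]|j _].
  + apply/seteqP; split=> [_ [j _ [i _ <-]]|z /= zX].
      exact: mem_nth.
    have zi : (index z (enum_fset X) < (r * (d + 1)).+1)%N.
      by rewrite -cardX index_mem.
    exists (s (Ordinal zi)) => //; exists (Ordinal zi) => //.
    exact: nth_index.
  + congr s; apply/val_inj/eqP.
    rewrite -(nth_uniq 0 (lt_size i) (lt_size i') (fset_uniq X)).
    exact/eqP/esym.
  + have [i si] : exists i, s i == j.
      apply/existsP; apply: contraT; rewrite negb_exists => /forallP sj.
      have [/eqP] := sl j; rewrite big_pred0 => [|i]; last exact: negPf (sj i).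
      by rewrite eq_sym oner_eq0.
    by exists (x i), i => //; exact/eqP.
- exists y => j _ A [cA FA]; have [sum_l <-] := sl j.
  apply: (convex_set_sum cA) => // i /eqP si.
  by apply: FA; exists i.
Qed.
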